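(* Let $X$ be a (real or complex) Banach space, and let $I_1(X)$ denote the set of all rank-one idempotent bounded linear operators on $X$. Let $\phi: I_1(X) \to I_1(X)$ be a bijective function for which \[ \operatorname{tr} \phi(P)\phi(Q) = \operatorname{tr} PQ \qquad (P,Q \in I_1(X)). \] Then either there exists a bijective bounded linear operator $A: X\to X$ such that \[ \phi(P) = APA^{-1} \qquad (P\in I_1(X)), \] or there exists a bijective bounded linear operator $C: X'\to X$ such that \[ \phi(P) = CP'C^{-1} \qquad (P\in I_1(X)). \]
   Context: For a Banach space $X$, $X'$ denotes its topological dual, and for a bounded linear operator $P$ on $X$, $P': X'\to X'$ denotes its Banach space adjoint. For $x\in X$ and $f\in X'$, $x\otimes f$ is the operator $(x\otimes f)(y)=f(y)x$ $(y\in X)$. Every bounded finite rank operator on $X$ can be written as $\sum_{i=1}^n x_i\otimes f_i$ with $x_i\in X$, $f_i\in X'$, and its trace is defined by $\operatorname{tr}\sum_{i=1}^n x_i\otimes f_i=\sum_{i=1}^n f_i(x_i)$ (this is well-defined and linear on the finite rank operators). The function $\phi$ is not assumed to be linear or continuous in any sense. *)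

(* Defs.v *)
From HB Require Import structures.
From mathcomp Require Import all_boot all_order all_algebra complex.
From mathcomp Require Import all_classical all_reals all_analysis.

Set Implicit Arguments.
Unset Strict Implicit.
Unset Printing Implicit Defensive.

Import Order.TTheory GRing.Theory Num.Theory.
Import numFieldNormedType.Exports.

Local Open Scope classical_set_scope.
Local Open Scope complex_scope.
Local Open Scope ring_scope.

Variant scalars := RealScalars | ComplexScalars.

Definition scalar_field (R : realType) (s : scalars) : numFieldType :=
  match s with RealScalars => R | ComplexScalars => R[i] end.

(* The norm of a normed module over K takes its values in K, so suprema of
   norms are taken for the partial order of K (x <= y means that y - x is a
   nonnegative real number). *)
Lemma scalar_isLub (R : realType) (s : scalars) (A : set (scalar_field R s)) :
  A !=set0 -> (forall x, A x -> 0 <= x) -> has_ubound A -> exists m, isLub A m.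
Proof.
case: s A => /= A [a Aa] A0 [b ubA].
  exists (sup A); split; first by apply: sup_upper_bound; split; [exists a|exists b].
  by move=> c ubc; apply: ge_sup => //; exists a.
pose B : set R := [set complex.Re x | x in A].
have hB : has_sup B.
  split; first by exists (complex.Re a); exists a.
  by exists (complex.Re b) => _ [x Ax <-]; have := ubA x Ax; rewrite lecE => /andP[].
have real_ge0 (x : R[i]) : 0 <= x -> x = (complex.Re x)%:C.
  by case: x => u v; rewrite lecE /= => /andP[/eqP -> _].
exists (sup B)%:C; split.
  move=> x Ax; rewrite (real_ge0 x (A0 x Ax)) lecR.
  by apply: sup_upper_bound => //; exists x.
move=> c ubc; have c0 : 0 <= c by apply: le_trans (ubc a Aa); exact: A0.
rewrite (real_ge0 c c0) lecR; apply: ge_sup; first by case: hB.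
by move=> _ [x Ax <-]; have := ubc x Ax; rewrite lecE => /andP[].
Qed.

Section BoundedOperators.
Context {K : numFieldType}.
Implicit Types V W : normedModType K.

Definition bounded_linear {V W} : {pred V -> W} :=
  fun f => `[< linear f /\ bounded_near f (nbhs (0 : V)) >].

Record blin V W := Blin { blin_fun :> V -> W; _ : blin_fun \in bounded_linear }.

HB.instance Definition _ V W := [isSub for @blin_fun V W].
HB.instance Definition _ V W := [Choice of blin V W by <:].

Lemma blin_linear V W (f : blin V W) : linear f.
Proof. by case: f => f /= /asboolP[]. Qed.

HB.instance Definition _ V W (f : blin V W) :=
  GRing.isLinear.Build K V W *:%R f (blin_linear f).

Lemma blin_bounded_near V W (f : blin V W) : bounded_near f (nbhs (0 : V)).
Proof. by case: f => f /= /asboolP[]. Qed.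

Lemma bounded_linearP V W (f : V -> W) :
  reflect (linear f /\ exists M, forall x, `|f x| <= M * `|x|)
    (f \in bounded_linear).
Proof.
apply: (iffP (asboolP _)) => -[lf bf]; split=> //.
  pose g : {linear V -> W} := HB.pack f (GRing.isLinear.Build _ _ _ _ _ lf).
  have /linear_boundedP/pinfty_ex_gt0[M _ HM] : bounded_near g (nbhs 0) by [].
  by exists M.
case: bf => M HM; apply/ex_bound; exists `|M|; apply/nbhs_norm0P.
exists 1 => //= x /= x1; rewrite (le_trans (HM x))//.
have [->|x0] := eqVneq x 0; first by rewrite normr0 mulr0.
have M0 : 0 <= M.
  by rewrite -(pmulr_lge0 M (_ : 0 < `|x|)) ?normr_gt0// (le_trans _ (HM x)).
by rewrite (ger0_norm M0) ler_piMr// ltW.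
Qed.

Lemma blin_bounded V W (f : blin V W) : exists M, forall x, `|f x| <= M * `|x|.
Proof. by case: (bounded_linearP f (valP f)). Qed.

Lemma bounded_linear_submod V W : submod_closed (@bounded_linear V W).
Proof.
split.
  apply/bounded_linearP; split; first by move=> k x y; rewrite /= scaler0 addr0.
  by exists 0 => x; rewrite normr0 mul0r.
move=> a f g /bounded_linearP[lf [M HM]] /bounded_linearP[lg [N HN]].
have E z : (a *: f + g) z = a *: f z + g z by [].
apply/bounded_linearP; split.
  move=> k x y; rewrite !E lf lg.
  by rewrite !scalerDr !scalerA (mulrC k) addrACA.
exists (`|a| * M + N) => x; rewrite E (le_trans (ler_normD _ _))// normrZ mulrDl.
by rewrite lerD// -mulrA ler_wpM2l.
Qed.

HB.instance Definition _ V W :=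
  GRing.isSubmodClosed.Build K (V -> W) bounded_linear
    (@bounded_linear_submod V W).
HB.instance Definition _ V W :=
  [SubChoice_isSubLmodule of blin V W by <:].

Lemma blinP V W (f g : blin V W) : f =1 g -> f = g.
Proof. by move=> fg; apply: val_inj; apply/funext. Qed.

Definition opnorm {V W} (f : blin V W) : K :=
  supremum 0 [set `|f x| | x in [set x : V | `|x| <= 1]].

Lemma bcomp_subproof V W U (f : blin W U) (g : blin V W) :
  (f : W -> U) \o (g : V -> W) \in bounded_linear.
Proof.
have [M HM] := blin_bounded f; have [N HN] := blin_bounded g.
apply/bounded_linearP; split; first by move=> k x y /=; rewrite !linearP.
exists (`|M| * N) => x /=; apply: (@le_trans _ _ (`|M| * `|g x|)).
  have [->|gx0] := eqVneq (g x) 0; first by rewrite linear0 !normr0 mulr0.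
  rewrite (le_trans (HM _))// ler_wpM2r// real_ler_norm//.
  rewrite ger0_real// -(pmulr_lge0 M (_ : 0 < `|g x|)) ?normr_gt0//.
  exact: le_trans (HM _).
by rewrite -mulrA ler_wpM2l.
Qed.

Definition bcomp {V W U} (f : blin W U) (g : blin V W) : blin V U :=
  Blin (bcomp_subproof f g).

Definition dual V := blin V (K^o : normedModType K).

Definition adjoint {V W} (P : blin V W) : dual W -> dual V :=
  fun f => bcomp f P.

Lemma tensor_subproof V W (x : W) (f : dual V) :
  (fun y => f y *: x) \in bounded_linear.
Proof.
have [M HM] := blin_bounded f.
apply/bounded_linearP; split; first by move=> k u v; rewrite linearP scalerDl scalerA.
exists (`|x| * M) => y; rewrite normrZ mulrC -mulrA.
by apply: ler_wpM2l => //; exact: HM.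
Qed.

Definition tensor {V W} (x : W) (f : dual V) : blin V W :=
  Blin (tensor_subproof x f).

Definition is_trace {V} (T : blin V V) (t : K) :=
  exists (n : nat) (x : 'I_n -> V) (f : 'I_n -> dual V),
    T = \sum_i tensor (x i) (f i) /\ t = \sum_i f i (x i).

(* A finite rank operator has exactly one trace in the sense of is_trace; the
   value 0 on the other operators is a junk value. *)
Definition tr {V} (T : blin V V) : K := xget 0 (is_trace T).

Definition rank_one {V W} (T : blin V W) :=
  exists2 x : W, x != 0 & range T = range (fun k : K => k *: x).

Definition I1 V : set (blin V V) :=
  [set P | rank_one P /\ bcomp P P = P].

End BoundedOperators.

Arguments I1 {K} V.

Section OperatorNorm.
Context {R : realType} {s : scalars}.
Let K := scalar_field R s.
Variables V W : normedModType K.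
Implicit Types f g : blin V W.

Lemma opnorm_isLub f :
  isLub [set `|f x| | x in [set x : V | `|x| <= 1]] (opnorm f).
Proof.
rewrite /opnorm /supremum; set A := [set _ | _ in _].
have A0 : A !=set0 by exists `|f 0|, 0; rewrite //= normr0 ler01.
case: ifPn => [/eqP A_eq0|_]; first by case: A0; rewrite A_eq0.
have [M HM] := blin_bounded f.
have [|x [y _ <-]//||m Am] := @scalar_isLub R s A => //.
  exists `|M| => _ [x /= x1 <-].
  have [->|x0] := eqVneq x 0; first by rewrite linear0 normr0.
  have M0 : 0 <= M.
    by rewrite -(pmulr_lge0 M (_ : 0 < `|x|)) ?normr_gt0// (le_trans _ (HM x)).
  by rewrite (le_trans (HM x))// (ger0_norm M0) ler_piMr.
by case: xgetP => [y _ //|/(_ m)]; case.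
Qed.

Lemma opnorm_ge0 f : 0 <= opnorm f.
Proof.
have [ub _] := opnorm_isLub f; rewrite -(normr0 W) -(linear0 f).
by apply: ub; exists 0; rewrite //= normr0 ler01.
Qed.

Lemma ler_opnorm f x : `|f x| <= opnorm f * `|x|.
Proof.
have [->|x0] := eqVneq x 0; first by rewrite linear0 !normr0 mulr0.
have nx0 : 0 < `|x| by rewrite normr_gt0.
have [ub _] := opnorm_isLub f.
have := ub `|f (`|x|^-1 *: x)|; rewrite linearZ /= normrZ normfV normr_id.
rewrite ler_pdivrMl// (mulrC `|x|); apply.
by exists (`|x|^-1 *: x); rewrite /= ?linearZ ?normrZ ?normfV ?normr_id// mulVf// gt_eqF.
Qed.

Lemma opnorm_le f M : 0 <= M -> (forall x, `|f x| <= M * `|x|) -> opnorm f <= M.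
Proof.
move=> M0 HM; have [_ lub] := opnorm_isLub f; apply: lub => _ [x /= x1 <-].
by rewrite (le_trans (HM x))// ler_piMr.
Qed.

Let opnormD f g : opnorm (f + g) <= opnorm f + opnorm g.
Proof.
apply: opnorm_le => [|x]; first by rewrite addr_ge0// opnorm_ge0.
by rewrite mulrDl (le_trans (ler_normD _ _))// lerD// ler_opnorm.
Qed.

Let opnormZ (k : K) f : opnorm (k *: f) = `|k| * opnorm f.
Proof.
have le_opnormZ (l : K) g : opnorm (l *: g) <= `|l| * opnorm g.
  apply: opnorm_le => [|x]; first by rewrite mulr_ge0// opnorm_ge0.
  by rewrite [leLHS]normrZ -mulrA ler_wpM2l// ler_opnorm.
apply/le_anti; rewrite le_opnormZ/=; have [->|k0] := eqVneq k 0.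
  by rewrite normr0 mul0r opnorm_ge0.
rewrite -ler_pdivlMl ?normr_gt0// -normfV (le_trans _ (le_opnormZ _ _))//.
by rewrite scalerA mulVf// scale1r.
Qed.

Let opnorm0_eq0 f : opnorm f = 0 -> f = 0.
Proof.
move=> f0; apply: blinP => x; apply/eqP; rewrite -normr_le0.
by rewrite (le_trans (ler_opnorm _ _))// f0 mul0r.
Qed.

HB.instance Definition _ :=
  Lmodule_isNormed.Build K (blin V W) opnormD opnormZ opnorm0_eq0.

Lemma blin_normE f : `|f| = opnorm f.
Proof. by []. Qed.

End OperatorNorm.

HB.instance Definition _ (R : realType) (s : scalars)
    (V : normedModType (scalar_field R s)) :=
  NormedModule.copy (dual V) (blin V (scalar_field R s)^o).

(* Main.v *)
(* The map [phi] preserves linear relations among rank-one idempotents, because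
   these are detected by the traces against all rank-one idempotents. For two
   idempotents with the same range, the midpoint is again a rank-one idempotent,
   and hence so is the midpoint of their images, which therefore share their
   range or their kernel. So [phi] sends the idempotents sharing their range
   with a fixed one either all to a common range or all to a common kernel. In
   the first case, [phi] of [x (x) f0] and of [x0 (x) f] define linear bijections
   [A : X -> X] and [B : X' -> X'] with [(B f) (A x) = f x], and the trace
   identity forces [phi (x (x) f) = A x (x) B f]. The second case is the first
   one with the roles of [X] and [X'] exchanged in the source; working with
   abstract dual pairs makes this symmetry literal.

   Every functional composed with [A] is bounded, so [A] is bounded by the
   uniform boundedness principle and the Hahn-Banach theorem. *)
Require Import Defs.
From HB Require Import structures.
From mathcomp Require Import all_boot all_order all_algebra complex ring lra.
From mathcomp Require Import all_classical all_reals all_analysis.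

Set Implicit Arguments.
Unset Strict Implicit.
Unset Printing Implicit Defensive.

Import Order.TTheory GRing.Theory Num.Theory.
Import numFieldNormedType.Exports.

Local Open Scope classical_set_scope.
Local Open Scope complex_scope.
Local Open Scope ring_scope.

(** * Dual pairs and trace-preserving relations *)

Record dual_pair (K : fieldType) (V W : lmodType K) := DualPair {
  pairing :> V -> W -> K;
  pairing_linl : forall w, linear (fun v => pairing v w : K^o);
  pairing_linr : forall v, linear (fun w => pairing v w : K^o);
  pairing_sepl : forall v, (forall w, pairing v w = 0) -> v = 0;
  pairing_sepr : forall w, (forall v, pairing v w = 0) -> w = 0 }.

Arguments pairing_linl {K V W} d w.
Arguments pairing_linr {K V W} d v.
Arguments pairing_sepl {K V W} d v.
Arguments pairing_sepr {K V W} d w.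

Definition dual_pair_flip (K : fieldType) (V W : lmodType K)
    (b : dual_pair V W) : dual_pair W V :=
  DualPair (pairing_linr b) (pairing_linl b) (pairing_sepr b) (pairing_sepl b).

Section DualPair.
Context {K : fieldType} {V W : lmodType K} (b : dual_pair V W).

Lemma pairDl v v' w : b (v + v') w = b v w + b v' w.
Proof. by have := pairing_linl b w 1 v v'; rewrite !scale1r. Qed.

Lemma pairDr v w w' : b v (w + w') = b v w + b v w'.
Proof. by have := pairing_linr b v 1 w w'; rewrite !scale1r. Qed.

Lemma pair0l w : b 0 w = 0.
Proof. by apply: (addrI (b 0 w)); rewrite -pairDl !addr0. Qed.

Lemma pair0r v : b v 0 = 0.
Proof. by apply: (addrI (b v 0)); rewrite -pairDr !addr0. Qed.

Lemma pairZl k v w : b (k *: v) w = k * b v w.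
Proof. by have := pairing_linl b w k v 0; rewrite pair0l !addr0. Qed.

Lemma pairZr k v w : b v (k *: w) = k * b v w.
Proof. by have := pairing_linr b v k w 0; rewrite pair0r !addr0. Qed.

Lemma pairNl v w : b (- v) w = - b v w.
Proof. by rewrite -scaleN1r pairZl mulN1r. Qed.

Lemma pairNr v w : b v (- w) = - b v w.
Proof. by rewrite -scaleN1r pairZr mulN1r. Qed.

Definition pairE := (pairDl, pairDr, pairNl, pairNr, pairZl, pairZr).

Lemma pair_extl v v' : b v =1 b v' -> v = v'.
Proof.
by move=> e; apply/subr0_eq/(pairing_sepl b) => w; rewrite !pairE e subrr.
Qed.

Lemma pair_sepl v : v != 0 -> exists w, b v w = 1.
Proof.
move=> v0; have [w bw] : exists w, b v w != 0.
  apply/not_existsP => h; case/negP: v0; apply/eqP/(pairing_sepl b) => w.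
  by apply/eqP; apply: contra_notT (h w).
by exists ((b v w)^-1 *: w); rewrite pairZr mulVf.
Qed.

(** With [b v w1 = 1], the vector [w - b v w *: w1] is killed by [v], hence by [v']; this identifies
    the factor as [b v' w1]. *)
Lemma pair_proportionall v v' :
  (forall w, b v w = 0 -> b v' w = 0) -> exists k, v' = k *: v.
Proof.
have [-> h|/pair_sepl[w1 bw1] h] := eqVneq v 0.
  by exists 0; rewrite scaler0; apply: (pairing_sepl b) => w; rewrite h// pair0l.
exists (b v' w1); apply: pair_extl => w; apply/subr0_eq.
have := h (w - b v w *: w1); rewrite !pairE bw1 mulr1 subrr => /(_ erefl).
by rewrite mulrC.
Qed.

End DualPair.

Section DualPairFlip.
Context {K : fieldType} {V W : lmodType K} (b : dual_pair V W).
Let b' := dual_pair_flip b.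

Lemma pair_extr w w' : b^~ w =1 b^~ w' -> w = w'.
Proof. exact: (@pair_extl _ _ _ b'). Qed.

Lemma pair_proportionalr w w' :
  (forall v, b v w = 0 -> b v w' = 0) -> exists k, w' = k *: w.
Proof. exact: (@pair_proportionall _ _ _ b'). Qed.

End DualPairFlip.

Lemma exists_neq2 (K : numFieldType) (a b : K) : exists t, t != a /\ t != b.
Proof.
have t0 : 0 <= `|a| + `|b| + 1 by rewrite !addr_ge0.
have lt_neq (x : K) : `|x| < `|a| + `|b| + 1 -> `|a| + `|b| + 1 != x.
  by apply: contraTneq => <-; rewrite ger0_norm// ltxx.
exists (`|a| + `|b| + 1); split; apply: lt_neq.
  by rewrite -addrA ltrDl ltr_wpDl.
by rewrite addrAC ltrDr ltr_wpDl.
Qed.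

Lemma exists_affine_neq0 (K : numFieldType) (a p b q : K) :
  p != 0 -> q != 0 -> exists t, a + t * p != 0 /\ b + t * q != 0.
Proof.
move=> p0 q0; have [t [ta tb]] := exists_neq2 (- a / p) (- b / q).
exists t; split.
  by apply: contraNneq ta => /eqP; rewrite addrC addr_eq0 => /eqP <-; rewrite mulfK.
by apply: contraNneq tb => /eqP; rewrite addrC addr_eq0 => /eqP <-; rewrite mulfK.
Qed.

(** * Bilinear identities from generic arguments *)

Section Density.
Context {K : numFieldType} {Y Z : lmodType K} (c : dual_pair Y Z).

(* The admissible vectors form a Zariski-open set containing [(y0, z0)], so
   every line through [y0] (and then through [z0]) meets it. *)
Lemma bilinear_vanish (beta : Y -> Z -> K) (y0 : Y) (z0 : Z) :
  (forall z, linear (fun y => beta y z : K^o)) ->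
  (forall y, linear (fun z => beta y z : K^o)) ->
  c y0 z0 != 0 ->
  (forall y z, c y z != 0 -> c y0 z != 0 -> c y z0 != 0 -> beta y z = 0) ->
  forall y z, beta y z = 0.
Proof.
move=> bl br c0 bg.
have step z : c y0 z != 0 -> forall y, beta y z = 0.
  move=> cz y.
  have [t [t1 t2]] := exists_affine_neq0 (c y z) (c y z0) cz c0.
  have := bl z t y0 y; rewrite (bg y0 z)// scaler0 add0r => <-.
  by apply: bg; rewrite // !pairE addrC.
move=> y z; have [t [t1 _]] := exists_affine_neq0 (c y0 z) 1 c0 (oner_neq0 K).
have := br y t z0 z; rewrite (step z0)// scaler0 add0r => <-.
by apply: step; rewrite !pairE addrC.
Qed.

(** Putting [s = y] in the identity exhibits [y] as a multiple of [y']; putting [t = z'] gives the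
    reciprocal factor for [z]. *)
Lemma tensor_eq (y y' : Y) (z z' : Z) : c y z = 1 -> c y' z' = 1 ->
  (forall s t, c s z * c y t = c s z' * c y' t) ->
  exists2 k, k != 0 & y = k *: y' /\ z = k^-1 *: z'.
Proof.
move=> c1 c1' e.
have ey : y = c y z' *: y'.
  by apply: (pair_extl (b := c)) => t; rewrite pairZl -e c1 mul1r.
have k0 : c y z' != 0.
  by apply: contraTneq isT => k0; rewrite k0 scale0r in ey; move: c1;
     rewrite ey pair0l => /eqP; rewrite eq_sym oner_eq0.
exists (c y z') => //; split=> //.
apply: (pair_extr (b := c)) => s; rewrite pairZr; apply: (mulIf k0).
by rewrite e c1' mulr1 mulrAC mulVf// mul1r.
Qed.

End Density.

Definition flip_source (V W Y Z : Type) (rho : V -> W -> Y -> Z -> Prop) :=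
  fun w v y z => rho v w y z.
Definition flip_target (V W Y Z : Type) (rho : V -> W -> Y -> Z -> Prop) :=
  fun v w z y => rho v w y z.
Definition rel_inv (V W Y Z : Type) (rho : V -> W -> Y -> Z -> Prop) :=
  fun y z v w => rho v w y z.

(* [rho v w y z] stands for "the idempotent [v (x) w] is sent to [y (x) z]". *)
Record trace_rel (K : fieldType) (V W Y Z : lmodType K) (b : dual_pair V W)
    (c : dual_pair Y Z) (rho : V -> W -> Y -> Z -> Prop) : Prop := TraceRel {
  rel_norm : forall v w y z, rho v w y z -> b v w = 1 /\ c y z = 1;
  rel_total : forall v w, b v w = 1 -> exists y z, rho v w y z;
  rel_surj : forall y z, c y z = 1 -> exists v w, rho v w y z;
  rel_scale_source : forall k v w y z, k != 0 ->
    rho v w y z -> rho (k *: v) (k^-1 *: w) y z;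
  rel_scale_target : forall k v w y z, k != 0 ->
    rho v w y z -> rho v w (k *: y) (k^-1 *: z);
  rel_trace : forall v w y z v' w' y' z', rho v w y z -> rho v' w' y' z' ->
    b v w' * b v' w = c y z' * c y' z }.

Section TraceRelSymmetries.
Context {K : fieldType} {V W Y Z : lmodType K}.
Context {b : dual_pair V W} {c : dual_pair Y Z} {rho : V -> W -> Y -> Z -> Prop}.
Hypothesis H : trace_rel b c rho.

Lemma trace_rel_flip_source :
  trace_rel (dual_pair_flip b) c (flip_source rho).
Proof.
case: H => n t s ss st f; split; rewrite /flip_source /=.
- by move=> w v y z /n.
- by move=> w v /t.
- by move=> y z /s[v [w r]]; exists w, v.
- by move=> k w v y z k0 /(ss k^-1); rewrite invr_eq0 invrK; apply.
- by move=> k w v y z k0 /(st k); apply.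
- by move=> w v y z w' v' y' z' r r'; rewrite mulrC (f _ _ _ _ _ _ _ _ r r').
Qed.

Lemma trace_rel_flip_target :
  trace_rel b (dual_pair_flip c) (flip_target rho).
Proof.
case: H => n t s ss st f; split; rewrite /flip_target /=.
- by move=> v w z y /n.
- by move=> v w /t[y [z r]]; exists z, y.
- by move=> z y /s.
- by move=> k v w z y k0 /(ss k); apply.
- by move=> k v w z y k0 /(st k^-1); rewrite invr_eq0 invrK; apply.
- by move=> v w z y v' w' z' y' r r'; rewrite (f _ _ _ _ _ _ _ _ r r') mulrC.
Qed.

Lemma trace_rel_inv : trace_rel c b (rel_inv rho).
Proof.
case: H => n t s ss st f; split; rewrite /rel_inv //.
- by move=> y z v w /n[].
- by move=> k y z v w k0 /(st k); apply.
- by move=> k y z v w k0 /(ss k); apply.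
- by move=> y z v w y' z' v' w' r r'; rewrite (f _ _ _ _ _ _ _ _ r r').
Qed.

End TraceRelSymmetries.

(** A row consists of the idempotents with a given range, a column of those with a given kernel.
    Under [flip_source] the notion concerns a column, and under [flip_target] it asks for a common
    kernel of the images. *)
Definition row_constant (K : fieldType) (V W Z : Type) (Y : lmodType K)
    (rho : V -> W -> Y -> Z -> Prop) (v0 : V) (y0 : Y) :=
  forall w y z, rho v0 w y z -> exists k, y = k *: y0.

(** * Recovery of idempotents from traces, and the images of a row *)

Section TraceRel.
Context {K : numFieldType} {V W Y Z : lmodType K}.
Context {b : dual_pair V W} {c : dual_pair Y Z} {rho : V -> W -> Y -> Z -> Prop}.
Hypothesis H : trace_rel b c rho.

(** By surjectivity, every pair with nonzero pairing becomes an image after rescaling [z], and such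
    pairs are dense enough for [bilinear_vanish]. *)
Lemma rel_bilinear_vanish (beta : Y -> Z -> K) v0 w0 y0 z0 :
  (forall z, linear (fun y => beta y z : K^o)) ->
  (forall y, linear (fun z => beta y z : K^o)) ->
  rho v0 w0 y0 z0 ->
  (forall v w y z, rho v w y z -> beta y z = 0) ->
  forall y z, beta y z = 0.
Proof.
move=> bl br r0 b0; have [_ c0] := rel_norm H r0.
apply: (bilinear_vanish (c := c) (y0 := y0) (z0 := z0)) => //.
  by rewrite c0 oner_neq0.
move=> y z cyz _ _; have [|v [w r]] := @rel_surj _ _ _ _ _ _ _ _ H y ((c y z)^-1 *: z).
  by rewrite pairZr mulVf.
have beta0 : beta y 0 = 0.
  by have := br y (-1) 0 0; rewrite !scaleN1r oppr0 addr0 addNr.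
have := br y (c y z)^-1 z 0; rewrite beta0 !addr0 (b0 v w)// => /esym/eqP.
by rewrite scaler_eq0 invr_eq0 (negPf cyz) /= => /eqP.
Qed.

(** The traces of a target idempotent against all images determine it: the difference of the two
    trace forms is bilinear and vanishes on the images. *)
Lemma rel_eq v0 w0 y0 z0 y z : rho v0 w0 y0 z0 -> c y z = 1 ->
  (forall v w s t, rho v w s t -> b v0 w * b v w0 = c y t * c s z) ->
  exists2 k, k != 0 & y = k *: y0 /\ z = k^-1 *: z0.
Proof.
move=> r0 cyz e; have [_ c0] := rel_norm H r0.
apply: (tensor_eq cyz c0) => s t; apply/subr0_eq.
pose beta s t := c s z * c y t - c s z0 * c y0 t.
apply: (rel_bilinear_vanish (beta := beta) _ _ r0) => [{}t k u v|{}s k u v|].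
- by rewrite /beta !pairE /GRing.scale /=; ring.
- by rewrite /beta !pairE /GRing.scale /=; ring.
- move=> v w {}s {}t r; apply/eqP; rewrite subr_eq0 mulrC -(e _ _ _ _ r).
  by rewrite (rel_trace H r0 r) mulrC.
Qed.

Lemma rel_unique v w y z y' z' : rho v w y z -> rho v w y' z' ->
  exists2 k, k != 0 & y' = k *: y /\ z' = k^-1 *: z.
Proof.
move=> r r'; apply: (rel_eq r); first by case: (rel_norm H r').
by move=> v1 w1 s t r1; rewrite (rel_trace H r' r1).
Qed.

(* The image of the midpoint of two points of a row is the midpoint of their
   images, and the midpoint of [y (x) z] and [y' (x) z'] has rank one only if
   they share their range or their kernel. *)
Lemma row_adjacent v0 w y z w' y' z' : rho v0 w y z -> rho v0 w' y' z' ->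
  (exists k, y' = k *: y) \/ (exists k, z' = k *: z).
Proof.
move=> r r'; have [b1 c1] := rel_norm H r; have [b1' c1'] := rel_norm H r'.
have [|y2 [z2 r2]] := @rel_total _ _ _ _ _ _ _ _ H v0 (2^-1 *: (w + w')).
  by rewrite !pairE b1 b1'; field.
have [zz'|/existsNP[s /not_implyP[sz sz']]] :=
    pselect (forall s, c s z = 0 -> c s z' = 0).
  by right; exact: pair_proportionalr zz'.
left; have mid u t : 2 * (c u z2 * c y2 t) = c u z * c y t + c u z' * c y' t.
  apply/subr0_eq.
  pose beta u t := 2 * (c u z2 * c y2 t) - (c u z * c y t + c u z' * c y' t).
  apply: (rel_bilinear_vanish (beta := beta) _ _ r) => [{}t k p q|{}u k p q|].
  - by rewrite /beta !pairE /GRing.scale /=; ring.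
  - by rewrite /beta !pairE /GRing.scale /=; ring.
  - move=> v1 w1 s1 t1 r1; rewrite /beta.
    have := rel_trace H r r1; have := rel_trace H r' r1; have := rel_trace H r2 r1.
    rewrite ![c y2 _ * _]mulrC ![c y _ * _]mulrC ![c y' _ * _]mulrC.
    by move=> <- <- <-; rewrite !pairE; field.
(* The vector [s] kills [z] but not [z'], so pairing the midpoint identity with it isolates [y'] as
   a multiple of [y2]. Pairing with [y] then does the same for [y]. *)
have y2E : y' = (2 * c s z2 / c s z') *: y2.
  apply: (pair_extl (b := c)) => t; rewrite pairZl; apply: (mulfI (x := c s z')).
    exact/eqP.
  have := mid s t; rewrite sz mul0r add0r => <-; field; exact/eqP.
set m := _ / _ in y2E.
have m0 : m != 0.
  apply/eqP => m0; move: c1'; rewrite y2E m0 scale0r pair0l => /eqP.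
  by rewrite eq_sym oner_eq0.
have yE : y = (2 * c y z2 - c y z' * m) *: y2.
  apply: (pair_extl (b := c)) => t; rewrite pairZl.
  have := mid y t; rewrite c1 y2E pairZl mul1r => /eqP.
  by rewrite -subr_eq => /eqP <-; ring.
set n := _ - _ in yE.
have n0 : n != 0.
  apply/eqP => n0; move: c1; rewrite yE n0 scale0r pair0l => /eqP.
  by rewrite eq_sym oner_eq0.
by exists (m / n); rewrite yE y2E scalerA divfK.
Qed.

(** Makes the pairwise alternative uniform. If one image leaves the range of the base image and
    another leaves its kernel, the first keeps the kernel and the second keeps the range, so these
    two share neither. *)
Lemma row_dichotomy v0 w0 y0 z0 : rho v0 w0 y0 z0 ->
  row_constant rho v0 y0 \/ row_constant (flip_target rho) v0 z0.
Proof.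
move=> r0.
have [|/existsNP[w1 /existsNP[y1 /existsNP[z1 /not_implyP[r1 ny]]]]] :=
  pselect (row_constant rho v0 y0); first by left.
have [|/existsNP[w2 /existsNP[z2 /existsNP[y2 /not_implyP[r2 nz]]]]] :=
  pselect (row_constant (flip_target rho) v0 z0); first by right.
exfalso.
have [//|[k zE]] := row_adjacent r0 r1.
have [[l yE]|//] := row_adjacent r0 r2.
have [[m y2E]|[m z2E]] := row_adjacent r1 r2; last first.
  by apply: nz; exists (m * k); rewrite z2E zE scalerA.
apply: ny; exists (m^-1 * l); rewrite -scalerA -yE y2E scalerA mulVf ?scale1r//.
apply/eqP => m0; have [_] := rel_norm H r2.
by rewrite y2E m0 scale0r pair0l => /eqP; rewrite eq_sym oner_eq0.
Qed.

Lemma row_total v0 w y0 : row_constant rho v0 y0 -> b v0 w = 1 ->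
  exists z, rho v0 w y0 z.
Proof.
move=> rc /(rel_total H)[y [z r]]; have [k yE] := rc _ _ _ r.
have k0 : k != 0.
  apply/eqP => k0; have [_] := rel_norm H r.
  by rewrite yE k0 scale0r pair0l => /eqP; rewrite eq_sym oner_eq0.
exists (k *: z); have := rel_scale_target H (k := k^-1) _ r.
by rewrite yE invrK scalerA mulVf// scale1r; apply; rewrite invr_eq0.
Qed.

(* Two idempotents sharing their range have a product of trace 1. *)
Lemma row_col_constant v0 w0 y0 z0 : rho v0 w0 y0 z0 ->
  row_constant rho v0 y0 -> row_constant (flip_source rho) w0 y0 ->
  row_constant (flip_target rho) v0 z0.
Proof.
move=> r0 rc cc w z y r; have [b0 _] := rel_norm H r0.
have [b1 c1] := rel_norm H r; have [k yE] := rc _ _ _ r.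
have one v : b v w0 = 1 -> b v w = 1.
  move=> bv; have [y' [z' r']] := rel_total H bv.
  have [_ c1'] := rel_norm H r'; have [k' yE'] := cc _ _ _ r'.
  have := rel_trace H r r'; rewrite b0 mul1r => ->.
  move: c1 c1'; rewrite yE yE' !pairZl => e e'.
  by rewrite mulrACA [c y0 z' * _]mulrC mulrACA e e' mulr1.
(* Each [v] can be moved along [v0] onto the hyperplane where [w0] is 1, and there [w] is 1 too. So
   the row contains only the base idempotent. *)
have wE : w0 = w.
  apply: (pair_extr (b := b)) => v.
  have := one (v + (1 - b v w0) *: v0); rewrite !pairE b0 b1 !mulr1 addrC subrK.
  move=> /(_ erefl) e; apply/subr0_eq; rewrite -(subrr 1) -[X in _ = _ - X]e.
  by ring.
move: r; rewrite -wE => r.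
by have [l _ [_ ->]] := rel_unique r0 r; exists l^-1.
Qed.

End TraceRel.

(** * The alternative at a base point *)

Section Dichotomy.
Context {K : numFieldType} {V W Y Z : lmodType K}.

(** Row and column choose between range and kernel separately. When they make the same choice,
    [row_col_constant] shows that the row satisfies the other alternative as well, which leads back
    to opposite choices. *)
Lemma base_dichotomy (b : dual_pair V W) (c : dual_pair Y Z) rho v0 w0 y0 z0 :
  trace_rel b c rho -> rho v0 w0 y0 z0 ->
  (row_constant rho v0 y0 /\
     row_constant (flip_source (flip_target rho)) w0 z0) \/
  (row_constant (flip_target rho) v0 z0 /\
     row_constant (flip_source rho) w0 y0).
Proof.
move=> H r0; have Ht := trace_rel_flip_target H.
have [rc|rc] := row_dichotomy H r0;
  have [cc|cc] := row_dichotomy (trace_rel_flip_source H) r0.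
- by right; split=> //; exact: (row_col_constant H r0 rc cc).
- by left.
- by right.
- by left; split=> //; exact: (row_col_constant Ht r0 rc cc).
Qed.

(** If the inverse relation had a common kernel on this row instead, each preimage could be scaled
    to [v (x) w0]. Column constancy then forces the image to be the base one, and uniqueness makes
    [v] proportional to [v0]. *)
Lemma row_constant_inv (b : dual_pair V W) (c : dual_pair Y Z) rho v0 w0 y0 z0 :
  trace_rel b c rho -> rho v0 w0 y0 z0 ->
  row_constant (flip_source (flip_target rho)) w0 z0 ->
  row_constant (rel_inv rho) y0 v0.
Proof.
move=> H r0 cc; have Hi := trace_rel_inv H.
have [//|ci] := row_dichotomy Hi (r0 : rel_inv rho y0 z0 v0 w0).
move=> z v w r; have [k wE] := ci _ _ _ r; have [b1 c1] := rel_norm H r.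
have [b0 c0] := rel_norm H r0.
have k0 : k != 0.
  apply/eqP => k0; move: b1.
  by rewrite wE k0 scale0r pair0r => /eqP; rewrite eq_sym oner_eq0.
have := rel_scale_source H k0 r; rewrite wE scalerA mulVf// scale1r => r1.
have [l zE] := cc _ _ _ r1.
have l1 : l = 1 by move: c1; rewrite zE pairZr c0 mulr1.
rewrite zE l1 scale1r in r1.
have [m _ [vE _]] := rel_unique Hi (r0 : rel_inv rho y0 z0 v0 w0) r1.
by exists (k^-1 * m); rewrite -scalerA -vE scalerA mulVf// scale1r.
Qed.

Lemma hyperplane_decomp (b : dual_pair V W) v0 w0 v : b v0 w0 = 1 ->
  exists2 v1, b v1 w0 = 1 & v = v1 + (b v w0 - 1) *: v0.
Proof.
move=> b0; exists (v - (b v w0 - 1) *: v0); last by rewrite subrK.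
by rewrite !pairE b0 mulr1 opprB addrC subrK.
Qed.

End Dichotomy.

(** * Extension from affine hyperplanes to the whole space *)

Section HyperplaneIsometry.
Context {K : numFieldType} {V W Y Z : lmodType K}.
Variables (b : dual_pair V W) (c : dual_pair Y Z).
Variables (RA : V -> Y -> Prop) (RB : W -> Z -> Prop).
Variables (v0 : V) (w0 : W) (y0 : Y) (z0 : Z).
Hypotheses (b0 : b v0 w0 = 1) (c0 : c y0 z0 = 1).
Hypotheses (RA0 : RA v0 y0) (RB0 : RB w0 z0).
Hypothesis RA_total : forall v, b v w0 = 1 -> exists y, RA v y.
Hypothesis RB_total : forall w, b v0 w = 1 -> exists z, RB w z.
Hypothesis RB_surj : forall z, c y0 z = 1 -> exists w, RB w z.
Hypothesis RAB : forall v y w z, RA v y -> RB w z -> b v w = c y z.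

Lemma hyperplane_sep y y' : (forall w z, RB w z -> c y z = c y' z) -> y = y'.
Proof.
move=> e; apply: (pair_extl (b := c)) => z.
have [z1 c1 ->] := hyperplane_decomp (b := dual_pair_flip c) z c0.
have [w1 r1] := RB_surj c1.
by rewrite !pairE (e _ _ r1) (e _ _ RB0).
Qed.

(** The hyperplane [b v w0 = 1] contains [v0] and spans [V], so the image of [v] is prescribed by a
    point of the hyperplane and a multiple of [y0]. *)
Lemma hyperplane_ext v : exists y, forall w z, RB w z -> b v w = c y z.
Proof.
have [v1 b1 ->] := hyperplane_decomp v b0; have [y1 r1] := RA_total b1.
exists (y1 + (b v w0 - 1) *: y0) => w z r.
by rewrite !pairE (RAB r1 r) (RAB RA0 r).
Qed.

Lemma hyperplane_ext_adj (A : V -> Y) :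
  (forall v w z, RB w z -> b v w = c (A v) z) ->
  forall w, exists z, forall v, b v w = c (A v) z.
Proof.
move=> AP w.
have [w1 b1 ->] := hyperplane_decomp (b := dual_pair_flip b) w b0.
have [z1 r1] := RB_total b1.
exists (z1 + (b v0 w - 1) *: z0) => v.
by rewrite !pairE (AP _ _ _ r1) (AP _ _ _ RB0).
Qed.

End HyperplaneIsometry.

(** * The operators defined by the row and the column of the base point *)

Section Extension.
Context {K : numFieldType} {V W Y Z : lmodType K}.
Variables (b : dual_pair V W) (c : dual_pair Y Z).
Variable rho : V -> W -> Y -> Z -> Prop.
Hypothesis H : trace_rel b c rho.
Variables (v0 : V) (w0 : W) (y0 : Y) (z0 : Z).
Hypothesis r0 : rho v0 w0 y0 z0.
Hypothesis row0 : row_constant rho v0 y0.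
Hypothesis col0 : row_constant (flip_source (flip_target rho)) w0 z0.

Let b0 : b v0 w0 = 1. Proof. by have [] := rel_norm H r0. Qed.
Let c0 : c y0 z0 = 1. Proof. by have [] := rel_norm H r0. Qed.

Let Hst := trace_rel_flip_source (trace_rel_flip_target H).

(** The column supplies [A] and the row supplies [B] on affine hyperplanes. The constructions for
    the inverse relation supply the inverses, and linearity of [A] follows because the images of the
    row separate points. *)
Lemma isometry_extension :
  exists (A : V -> Y) (A' : Y -> V) (B : W -> Z) (B' : Z -> W),
  [/\ linear A, cancel A A', cancel A' A & cancel B' B] /\
  [/\ forall v w, c (A v) (B w) = b v w,
      forall v, b v w0 = 1 -> rho v w0 (A v) z0 &
      forall w, b v0 w = 1 -> rho v0 w y0 (B w)].
Proof.
have rowi : row_constant (rel_inv rho) y0 v0 := row_constant_inv H r0 col0.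
have coli : row_constant (rel_inv (flip_source (flip_target rho))) z0 w0.
  exact: (row_constant_inv Hst r0 row0).
have Hi := trace_rel_inv H; have Hsti := trace_rel_inv Hst.
have rowT w : b v0 w = 1 -> exists z, rho v0 w y0 z by exact: (row_total H row0).
have colT v : b v w0 = 1 -> exists y, rho v w0 y z0.
  exact: (row_total Hst col0).
have rowS z : c y0 z = 1 -> exists w, rho v0 w y0 z by exact: (row_total Hi rowi).
have colS y : c y z0 = 1 -> exists v, rho v w0 y z0 by exact: (row_total Hsti coli).
(* The trace of a column idempotent times a row idempotent has [b v0 w0 = 1] as its other factor,
   and likewise in the target. *)
have RAB v y w z : rho v w0 y z0 -> rho v0 w y0 z -> b v w = c y z.
  by move=> r r'; have := rel_trace H r r'; rewrite b0 c0 !mulr1.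
have sepY := @hyperplane_sep K W Y Z c (fun w z => rho v0 w y0 z) w0 y0 z0 c0 r0 rowS.
have sepV := @hyperplane_sep K Z V W b (fun z w => rho v0 w y0 z) z0 v0 w0 b0 r0 rowT.
have /choice[A AP] v : exists y, forall w z, rho v0 w y0 z -> b v w = c y z.
  exact: (hyperplane_ext b0 (RA := fun v y => rho v w0 y z0) r0).
have /choice[A' AP'] y : exists v, forall z w, rho v0 w y0 z -> c y z = b v w.
  apply: (hyperplane_ext c0 (RA := fun y v => rho v w0 y z0) r0) => //.
  by move=> {}y v z w r r'; rewrite (RAB v y w z).
have /choice[B BP] w : exists z, forall v, b v w = c (A v) z.
  exact: (hyperplane_ext_adj b0 (RB := fun w z => rho v0 w y0 z) r0).
have /choice[B' BP'] z : exists w, forall y, c y z = b (A' y) w.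
  by apply: (hyperplane_ext_adj c0 (RB := fun z w => rho v0 w y0 z) r0).
have AK : cancel A A'.
  by move=> v; apply: sepV => z w r; rewrite -(AP' _ z)// -(AP v w z).
have AK' : cancel A' A.
  by move=> y; apply: sepY => w z r; rewrite -(AP _ w z)// -(AP' y z).
exists A, A', B, B'; split; split => //.
- move=> k u v; apply: sepY => w z r.
  by rewrite !pairE -!(AP _ w z)// !pairE.
- by move=> z; apply: (pair_extr (b := c)) => y; rewrite [RHS]BP' -{1}(AK' y) -BP.
- move=> v bv; have [y r] := colT _ bv; rewrite (_ : A v = y)//.
  by apply: sepY => w z r'; rewrite -(AP v w z)// (RAB v y w z).
- move=> w bw; have [z r] := rowT _ bw; rewrite (_ : B w = z)//.
  by apply: (pair_extr (b := c)) => y; rewrite (AP' _ _ _ r) -{1}(AK' y) -BP.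
Qed.

End Extension.

(** * Spatial form of the relation *)

Section Spatial.
Context {K : numFieldType} {V W Y Z : lmodType K}.
Variables (b : dual_pair V W) (c : dual_pair Y Z).
Variable rho : V -> W -> Y -> Z -> Prop.
Hypothesis H : trace_rel b c rho.

Lemma spatial v0 w0 y0 z0 : rho v0 w0 y0 z0 -> row_constant rho v0 y0 ->
  row_constant (flip_source (flip_target rho)) w0 z0 ->
  exists (A : V -> Y) (A' : Y -> V) (B : W -> Z) (B' : Z -> W),
  [/\ linear A, cancel A A' & cancel A' A] /\
  [/\ cancel B' B, forall v w, c (A v) (B w) = b v w &
      forall v w, b v w = 1 -> rho v w (A v) (B w)].
Proof.
move=> r0 row0 col0; have [b0 c0] := rel_norm H r0.
have [A [A' [B [B' [[linA AK AK' BK'] [AB RA RB]]]]]] :=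
  isometry_extension H r0 row0 col0.
exists A, A', B, B'; split; split=> //.
have Bw0 : B w0 = z0.
  have r := RB _ b0; have [k k0 [_ zE]] := rel_unique H r0 r.
  by have [_] := rel_norm H r; rewrite zE pairZr c0 mulr1 => ->; rewrite scale1r.
have Av0 : A v0 = y0.
  have r := RA _ b0; have [k k0 [yE _]] := rel_unique H r0 r.
  by have [_] := rel_norm H r; rewrite yE pairZl c0 mulr1 => ->; rewrite scale1r.
have cB p q : c p (B q) = b (A' p) q by rewrite -AB AK'.
have linA' p q k : A (p + k *: q) = A p + k *: A q by rewrite addrC linA addrC.
(* Comparing with the row and the column of the base point settles the
   idempotents not orthogonal to it on either side. *)
have good v w y z : b v w0 != 0 -> b v0 w != 0 -> rho v w y z ->
    forall s t, c s z * c y t = c s (B w) * c (A v) t.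
  move=> bv bw r.
  have eB w' : b v0 w' = 1 -> b v0 w * b v w' = c y0 z * c y (B w').
    by move=> bw'; have := rel_trace H (RB _ bw') r; rewrite mulrC => ->; rewrite mulrC.
  have eA v' : b v' w0 = 1 -> b v w0 * b v' w = c y z0 * c (A v') z.
    by move=> bv'; rewrite (rel_trace H r (RA _ bv')).
  have {}eB w' : b v0 w * b v w' = c y0 z * c y (B w').
    have [w1 bw1 ->] := hyperplane_decomp (b := dual_pair_flip b) w' b0.
    rewrite cB !pairE !mulrDr eB// cB; congr (_ + _).
    rewrite [LHS]mulrCA [RHS]mulrCA -cB Bw0; congr (_ * _).
    exact: (rel_trace H r0 r).
  have {}eA v' : b v w0 * b v' w = c y z0 * c (A v') z.
    have [v1 bv1 ->] := hyperplane_decomp v' b0.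
    rewrite linA' !pairE !mulrDr eA//; congr (_ + _).
    rewrite [LHS]mulrCA [RHS]mulrCA Av0; congr (_ * _).
    exact: (rel_trace H r r0).
  move=> s t; rewrite -(AK' s) -(BK' t) !AB.
  apply: (mulfI (mulf_neq0 bw bv)).
  transitivity ((b v0 w * b v (B' t)) * (b v w0 * b (A' s) w)); last by ring.
  by rewrite eA eB (rel_trace H r0 r); ring.
move=> v w bvw; have [y [z r]] := rel_total H bvw; have [_ cyz] := rel_norm H r.
have cAB : c (A v) (B w) = 1 by rewrite AB.
have [|k k0 [yE zE]] := tensor_eq cyz cAB; last first.
  have := rel_scale_target H (k := k^-1) _ r.
  by rewrite invr_eq0 invrK yE zE !scalerA mulVf// divff// !scale1r; apply.
move=> s t; apply/subr0_eq.
pose beta s t := c s z * c y t - c s (B w) * c (A v) t.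
apply: (bilinear_vanish (c := c) (beta := beta) (y0 := y0) (z0 := z0)).
- by move=> {}t k p q; rewrite /beta !pairE /GRing.scale /=; ring.
- by move=> {}s k p q; rewrite /beta !pairE /GRing.scale /=; ring.
- by rewrite c0 oner_neq0.
move=> {}s {}t st y0t sz0.
(* The test idempotent [A' s (x) w'] is not orthogonal to the base point on either side, so [good]
   identifies its image. Its trace against [v (x) w] then gives the required equality at
   [(s, t)]. *)
set w' := (c s t)^-1 *: B' t.
have bs p : b p w' = (c s t)^-1 * c (A p) t.
  by rewrite pairZr -AB BK'.
have [|y' [z' r']] := @rel_total _ _ _ _ _ _ _ _ H (A' s) w'.
  by rewrite bs AK' mulVf.
have := rel_trace H r r'.
rewrite (good _ _ _ _ _ _ r') ?bs ?AK' -?cB ?cB; last first.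
- by rewrite Av0 mulf_neq0// invr_eq0.
- by rewrite -AB AK' Bw0.
rewrite bs AK' -AB AK' -!mulrA => /(mulfI (invr_neq0 st)) e.
by rewrite /beta mulrC -e mulrC subrr.
Qed.
End Spatial.

(** * The Hahn-Banach theorem *)

Section HahnBanach.
Context {R : realType} {E : lmodType R} (p : E -> R).
Hypothesis p_add : forall x y, p (x + y) <= p x + p y.
Hypothesis p_scale : forall a x, p (a *: x) = `|a| * p x.

(** Partial linear functionals below [p], encoded as graphs so that chains have unions of the same
    kind. Single-valuedness follows: the difference of two values at a point is at most
    [p 0 = 0]. *)
Definition dominated_graph (G : set (E * R)) :=
  [/\ forall x y r t, G (x, r) -> G (y, t) -> G (x + y, r + t),
      forall a x r, G (x, r) -> G (a *: x, a * r) &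
      forall x r, G (x, r) -> r <= p x].

Lemma dominated_graph_extend G y : dominated_graph G -> G (0, 0) ->
  exists2 c, G `<=` [set (x.1 + t *: y, x.2 + t * c) | x in G & t in [set: R]] &
    dominated_graph [set (x.1 + t *: y, x.2 + t * c) | x in G & t in [set: R]].
Proof.
move=> [Gadd Gscale Gdom] G0.
(* A value at [y] must lie above every [r - p (x - y)] and below every [p (x + y) - r].
   Subadditivity orders these bounds, so the supremum of the lower ones is admissible. *)
pose S := [set z.2 - p (z.1 - y) | z in G].
have pN x : p (- x) = p x by rewrite -scaleN1r p_scale normrN1 mul1r.
have ubS x r : G (x, r) -> ubound S (p (x + y) - r).
  move=> Gx _ [[x' r'] Gx' <-] /=; have := Gdom _ _ (Gadd _ _ _ _ Gx Gx').
  have := p_add (x + y) (x' - y); rewrite addrACA subrr addr0; lra.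
have S0 : S !=set0 by exists (0 - p (0 - y)), (0, 0).
pose c := sup S.
have c_ge x r : G (x, r) -> r - p (x - y) <= c.
  move=> Gx; apply: ub_le_sup; last by exists (x, r).
  by exists (p (0 + y) - 0); exact: ubS.
have c_le x r : G (x, r) -> c <= p (x + y) - r by move=> /ubS; exact: ge_sup.
exists c.
  move=> [x r] Gx; exists (x, r) => //.
  by exists 0; rewrite //= scale0r mul0r !addr0.
split.
- move=> _ _ _ _ [[x r] Gx [a _ [<- <-]]] [[x' r'] Gx' [a' _ [<- <-]]] /=.
  exists (x + x', r + r'); first exact: Gadd.
  by exists (a + a') => //=; rewrite scalerDl addrACA mulrDl [r + r' + _]addrACA.
- move=> k _ _ [[x r] Gx [a _ [<- <-]]] /=.
  exists (k *: x, k * r); first exact: Gscale.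
  by exists (k * a) => //=; rewrite scalerDr scalerA mulrDr mulrA.
- move=> _ _ [[x r] Gx [a _ [<- <-]]] /=.
  have [a0|a0|->] := ltgtP a 0; last by rewrite scale0r mul0r !addr0; exact: Gdom.
  + have := c_ge _ _ (Gscale (- a^-1) _ _ Gx).
    have -> : x + a *: y = - a *: (- a^-1 *: x - y).
      by rewrite scalerBr scalerA mulrNN mulfV ?lt_eqF// scale1r scaleNr opprK.
    rewrite p_scale gtr0_norm ?oppr_gt0// -(ler_nM2l a0) => h.
    rewrite -subr_ge0; move: h; rewrite -subr_le0.
    have -> : r = a * (a^-1 * r) by rewrite mulVKf// lt_eqF.
    set q := a^-1 * r; rewrite (_ : - a^-1 * _ = - q); last first.
      by rewrite /q mulVKf ?lt_eqF// mulNr.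
    set P := p _; nra.
  + have := c_le _ _ (Gscale (a^-1) _ _ Gx).
    have -> : x + a *: y = a *: (a^-1 *: x + y).
      by rewrite scalerDr scalerA mulfV ?gt_eqF// scale1r.
    rewrite p_scale gtr0_norm// -(ler_pM2l a0) mulrBr mulVKf ?gt_eqF//; lra.
Qed.

Lemma hahn_banach (x0 : E) : exists u : E -> R,
  [/\ linear (u : E -> R^o), forall x, u x <= p x & u x0 = p x0].
Proof.
pose G0 : set (E * R) := [set (a *: x0, a * p x0) | a in [set: R]].
pose P (G : set (E * R)) := dominated_graph G /\ (G !=set0 -> G0 `<=` G).
have p_ge0 x : 0 <= p x.
  have := p_add x (- x); rewrite subrr -scaleN1r p_scale normrN1 mul1r.
  by rewrite -(scale0r x) p_scale normr0 mul0r; lra.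
have PG0 : P G0.
  split; last by move=> _; exact: subset_refl.
  split.
  - move=> _ _ _ _ [a _ [<- <-]] [b _ [<- <-]].
    by exists (a + b); rewrite // scalerDl mulrDl.
  - by move=> k _ _ [a _ [<- <-]]; exists (k * a); rewrite // scalerA mulrA.
  - move=> _ _ [a _ [<- <-]]; rewrite p_scale.
    by apply: ler_wpM2r => //; exact: ler_norm.
have [|G [[dG G0G] maxG]] := @Zorn_bigcup _ P.
  move=> F FP totF; split; last first.
    by move=> [z [G FG Gz]] w G0w; exists G => //; apply: (FP _ FG).2 => //; exists z.
  split.
  - move=> x y r t [A FA Ax] [B FB By].
    have [AB|BA] := totF _ _ FA FB.
      by exists B => //; case: (FP _ FB) => -[+ _ _] _; apply => //; exact: AB.
    by exists A => //; case: (FP _ FA) => -[+ _ _] _; apply => //; exact: BA.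
  - by move=> a x r [A FA Ax]; exists A => //; case: (FP _ FA) => -[_ + _] _; apply.
  - by move=> x r [A FA Ax]; case: (FP _ FA) => -[_ _ +] _; apply.
have {}G0G : G0 `<=` G.
  apply: G0G; apply/set0P/eqP => G_0; apply: (maxG G0) => //.
  rewrite G_0; split; first exact: sub0set.
  by move=> /(_ (0 *: x0, 0 * p x0)); apply; exists 0.
have G00 : G (0, 0) by apply: G0G; exists 0; rewrite // scale0r mul0r.
have [Gadd Gscale Gdom] := dG.
have /choice[u uP] y : exists r, G (y, r).
  have [c GG' dG'] := dominated_graph_extend y dG G00.
  set G' := [set _ | _ in _ & _ in _] in GG' dG'.
  have G'y : G' (y, c).
    by exists (0, 0) => //; exists 1; rewrite //= scale1r mul1r !add0r.
  exists c; apply: contrapT => nGy; apply: (maxG G').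
    by split=> // /(_ _ G'y).
  by split=> // _; exact: subset_trans GG'.
have Guniq x r t : G (x, r) -> G (x, t) -> r = t.
  have le a b : G (x, a) -> G (x, b) -> a <= b.
    move=> Ga Gb; have := Gdom _ _ (Gadd _ _ _ _ Ga (Gscale (-1) _ _ Gb)).
    by rewrite scaleN1r subrr -(scale0r 0) p_scale normr0 mul0r mulN1r subr_le0.
  by move=> Gr Gt; apply/eqP; rewrite eq_le !le.
exists u; split.
- move=> k x y; apply: (Guniq (k *: x + y)) => //; apply: Gadd => //; exact: Gscale.
- by move=> x; exact: Gdom.
- by apply: (Guniq x0) => //; apply: G0G; exists 1; rewrite // scale1r mul1r.
Qed.

End HahnBanach.

(** * Uniform treatment of real and complex scalars *)

Section Scalars.
Context {R : realType} {s : scalars}.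
Local Notation K := (scalar_field R s).

Definition re_part : K -> R :=
  match s return scalar_field R s -> R with
  | RealScalars => id
  | ComplexScalars => @complex.Re R
  end.

Definition of_real : R -> K :=
  match s return R -> scalar_field R s with
  | RealScalars => id
  | ComplexScalars => fun a => a%:C
  end.

Lemma re_partD (x y : K) : re_part (x + y) = re_part x + re_part y.
Proof. by rewrite /re_part; case: s x y => //= -[a b] [c d]. Qed.

Lemma re_part_of_realM (a : R) (x : K) : re_part (of_real a * x) = a * re_part x.
Proof.
rewrite /re_part /of_real; case: s x => //= -[b c].
by simpc.
Qed.

Lemma of_realK : cancel of_real re_part.
Proof. by rewrite /re_part /of_real; case: s. Qed.

Lemma of_real_re (x : K) : 0 <= x -> of_real (re_part x) = x.
Proof.
rewrite /re_part /of_real; case: s x => //= -[a b].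
by rewrite lecE /= => /andP[/eqP->].
Qed.

Lemma ler_of_real (a b : R) : (of_real a <= of_real b) = (a <= b).
Proof. by rewrite /of_real; case: s => //=; rewrite lecR. Qed.

Lemma ltr_of_real (a b : R) : (of_real a < of_real b) = (a < b).
Proof. by rewrite /of_real; case: s => //=; rewrite ltcR. Qed.

Lemma of_realD (a b : R) : of_real (a + b) = of_real a + of_real b.
Proof. by rewrite /of_real; case: s => //=; rewrite rmorphD. Qed.

Lemma of_realM (a b : R) : of_real (a * b) = of_real a * of_real b.
Proof. by rewrite /of_real; case: s => //=; rewrite rmorphM. Qed.

Lemma of_real0 : of_real 0 = 0.
Proof. by rewrite /of_real; case: s. Qed.

Lemma of_real1 : of_real 1 = 1.
Proof. by rewrite /of_real; case: s. Qed.

Lemma re_part0 : re_part (0 : K) = 0.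
Proof. by rewrite -of_real0 of_realK. Qed.

Lemma re_part1 : re_part (1 : K) = 1.
Proof. by rewrite -of_real1 of_realK. Qed.

Lemma of_realN (a : R) : of_real (- a) = - of_real a.
Proof. by rewrite /of_real; case: s => //=; rewrite rmorphN. Qed.

Lemma norm_of_real (a : R) : `|of_real a| = of_real `|a|.
Proof.
by rewrite /of_real; case: s => //=; rewrite normc_def /= expr0n addr0 sqrtr_sqr.
Qed.

Lemma ler_re_part_norm (x : K) : re_part x <= re_part `|x|.
Proof.
rewrite /re_part; case: s x => /= x; first exact: ler_norm.
have := normc_ge_Re x; rewrite lecE => /andP[_].
exact: le_trans (ler_norm _).
Qed.

Lemma re_partN (x : K) : re_part (- x) = - re_part x.
Proof. by rewrite -mulN1r -of_real1 -of_realN re_part_of_realM mulN1r. Qed.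

Lemma ler_norm_re_part (x : K) : `|re_part x| <= re_part `|x|.
Proof.
by rewrite ler_norml ler_re_part_norm andbT lerNl -re_partN -normrN ler_re_part_norm.
Qed.

Lemma ler_re_part (x y : K) : x <= y -> re_part x <= re_part y.
Proof. by rewrite /re_part; case: s x y => //= x y; rewrite lecE => /andP[]. Qed.

End Scalars.

Section RealNorm.
Context {R : realType} {s : scalars}.
Local Notation K := (scalar_field R s).

(** The norm takes values in [K]; this is the same number in [R], where the order is total and
    suprema exist. *)
Definition rnorm {V : normedModType K} (x : V) : R := re_part `|x|.

Section OneSpace.
Context {V : normedModType K}.
Implicit Types x y : V.

Lemma normE x : `|x| = of_real (rnorm x).
Proof. by rewrite /rnorm of_real_re. Qed.

Lemma rnorm_ge0 x : 0 <= rnorm x.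
Proof. by rewrite -(ler_of_real (s := s)) -normE of_real0. Qed.

Lemma ler_rnormD x y : rnorm (x + y) <= rnorm x + rnorm y.
Proof. by rewrite -(ler_of_real (s := s)) of_realD -!normE ler_normD. Qed.

Lemma rnorm0 : rnorm (0 : V) = 0.
Proof. by rewrite /rnorm normr0 re_part0. Qed.

Lemma rnormN x : rnorm (- x) = rnorm x.
Proof. by rewrite /rnorm normrN. Qed.

Lemma rdistC x y : rnorm (x - y) = rnorm (y - x).
Proof. by rewrite -rnormN opprB. Qed.

Lemma rnormZ_real (a : R) x : rnorm (of_real a *: x) = `|a| * rnorm x.
Proof. by rewrite /rnorm normrZ norm_of_real re_part_of_realM. Qed.

Lemma rnormZ (k : K) x : rnorm (k *: x) = re_part `|k| * rnorm x.
Proof. by rewrite {1}/rnorm normrZ -{1}(of_real_re (normr_ge0 k)) re_part_of_realM. Qed.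

End OneSpace.

Lemma bounded_rnormP {V W : normedModType K} (f : V -> W) :
  (exists M, forall x, `|f x| <= M * `|x|) <->
  (exists M, forall x, rnorm (f x) <= M * rnorm x).
Proof.
split=> -[M HM]; last first.
  by exists (of_real M) => x; rewrite !normE -of_realM ler_of_real.
exists (re_part `|M|) => x.
have [->|x0] := eqVneq x 0.
  have /eqP : `|f 0| <= 0 by rewrite (le_trans (HM 0))// normr0 mulr0.
  by rewrite rnorm0 mulr0 /rnorm => /eqP/ler_re_part; rewrite re_part0.
have M0 : 0 <= M.
  by rewrite -(pmulr_lge0 M (_ : 0 < `|x|)) ?normr_gt0// (le_trans _ (HM x)).
rewrite ger0_norm// -(ler_of_real (s := s)) of_realM -!normE of_real_re//.
Qed.

Lemma blin_rbounded {V W : normedModType K} (f : blin V W) :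
  exists M, forall x, rnorm (f x) <= M * rnorm x.
Proof. exact/bounded_rnormP/blin_bounded. Qed.

Lemma bounded_linear_rnorm {V W : normedModType K} (f : V -> W) : linear f ->
  (exists M, forall x, rnorm (f x) <= M * rnorm x) -> f \in bounded_linear.
Proof. by move=> lf /bounded_rnormP bf; exact/bounded_linearP. Qed.

Lemma ler_rnorm_blin {V W : normedModType K} (f : blin V W) x :
  rnorm (f x) <= rnorm f * rnorm x.
Proof. by rewrite -(ler_of_real (s := s)) of_realM -!normE ler_opnorm. Qed.

Lemma rnorm_blin_le {V W : normedModType K} (f : blin V W) M : 0 <= M ->
  (forall x, rnorm (f x) <= M * rnorm x) -> rnorm f <= M.
Proof.
move=> M0 HM; rewrite -(ler_of_real (s := s)) -normE.
apply: opnorm_le => [|x]; first by rewrite -of_real0 ler_of_real.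
by rewrite !normE -of_realM ler_of_real.
Qed.

(* Rotating [x] so that [f x] becomes a nonnegative real. *)
Lemma rnorm_le_re_part {V : normedModType K} (f : V -> K^o) M : linear f ->
  (forall x, re_part (f x) <= M * rnorm x) ->
  forall x, rnorm (f x) <= M * rnorm x.
Proof.
move=> lf HM x.
have f0 : f 0 = 0 by have := lf (-1) 0 0; rewrite !scaleN1r oppr0 addr0 addNr.
have [fx0|fx0] := eqVneq (f x) 0.
  have := HM x; rewrite fx0 rnorm0 re_part0.
  exact.
have := HM ((`|f x| / f x) *: x); rewrite -[_ *: x]addr0 lf f0 !addr0.
rewrite /GRing.scale /= divfK// rnormZ normrM normfV normr_id.
by rewrite mulfV ?normr_eq0// re_part1 mul1r.
Qed.

End RealNorm.

(** * Bounded functionals from their real parts *)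

Section RealFunctionals.
Context {R : realType} {s : scalars}.
Local Notation K := (scalar_field R s).

(* Over the complex scalars this is [x |-> u x - i u (i x)]. *)
Lemma dual_of_real_part {V : normedModType K} (u : V -> R) M :
  (forall x y, u (x + y) = u x + u y) ->
  (forall a x, u (of_real a *: x) = a * u x) ->
  (forall x, u x <= M * rnorm x) ->
  exists f : dual V, forall x, re_part (f x) = u x.
Proof.
move=> uD uZ uM.
suff [f lf fu] : exists2 f : V -> K^o, linear f & forall x, re_part (f x) = u x.
  have bf : f \in bounded_linear.
    apply: bounded_linear_rnorm => //; exists M; apply: rnorm_le_re_part => // x.
    by rewrite fu.
  by exists (Blin bf).
move: uD uZ {uM}; rewrite /re_part /of_real; case: s V u => /= V u uD uZ.
  by exists u => // k x y; rewrite uD uZ.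
exists (fun x => u x +i* (- u ('i *: x)) : R[i]^o) => //= k x y.
case: k => a b.
have uC (c d : R) z : u ((c +i* d) *: z) = c * u z + d * u ('i *: z).
  rewrite -!uZ -uD scalerA -scalerDl; congr (u (_ *: _)).
  by apply/eqP; rewrite eq_complex /=; apply/andP; split; apply/eqP; ring.
rewrite scalerDr !uD scalerA (uC a b).
have -> : 'i * (a +i* b) = (- b) +i* a :> R[i] by simpc.
rewrite (uC (- b) a); set p := u ('i *: x); set q := u ('i *: y).
by rewrite /GRing.scale /=; simpc; congr (_ +i* _); ring.
Qed.

(** A copy of [V] that carries the real scalar action apart from the one over [K]. *)
Definition realify (V : lmodType K) : Type := V.

HB.instance Definition _ (V : lmodType K) := GRing.Zmodule.on (realify V).

Section Realify.
Variable V : lmodType K.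
Let rscale (a : R) (x : realify V) : realify V := of_real a *: (x : V).

Let rscaleA a b x : rscale a (rscale b x) = rscale (a * b) x.
Proof. by rewrite /rscale scalerA of_realM. Qed.

Let rscale1 : left_id 1 rscale.
Proof. by move=> x; rewrite /rscale of_real1 scale1r. Qed.

Let rscaleDr : right_distributive rscale +%R.
Proof. by move=> a x y; rewrite /rscale scalerDr. Qed.

Let rscaleDl x : {morph rscale^~ x : a b / a + b}.
Proof. by move=> a b; rewrite /rscale of_realD scalerDl. Qed.

HB.instance Definition _ := GRing.Zmodule_isLmodule.Build R (realify V)
  rscaleA rscale1 rscaleDr rscaleDl.

Lemma realify_scaleE (a : R) (x : realify V) : a *: x = of_real a *: (x : V).
Proof. by []. Qed.

End Realify.

(** Hahn-Banach with the norm as dominating seminorm gives a real functional, which is the real part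
    of a functional over [K] with the same bound. *)
Lemma norming_functional {V : normedModType K} (y : V) :
  exists2 g : dual V, re_part (g y) = rnorm y & forall x, rnorm (g x) <= rnorm x.
Proof.
have [|a x|u [lu u_le uy]] := @hahn_banach R (realify V) (@rnorm R s V) _ _ y.
- by move=> u v; exact: ler_rnormD.
- by rewrite realify_scaleE rnormZ_real.
have [v w|a x|x|g gu] := @dual_of_real_part V u 1.
- by have := lu 1 v w; rewrite !scale1r.
- have u_0 : u 0 = 0.
    by apply: (addrI (u 0)); have := lu 1 0 0; rewrite !scale1r !addr0.
  by have := lu a x 0; rewrite u_0 !addr0.
- by rewrite mul1r u_le.
exists g; first by rewrite gu.
move=> x; rewrite -[leRHS]mul1r.
apply: rnorm_le_re_part => [|{}x]; first exact: blin_linear.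
by rewrite gu mul1r u_le.
Qed.

Lemma dual_separates {V : normedModType K} (x : V) :
  (forall f : dual V, f x = 0) -> x = 0.
Proof.
move=> fx0; have [g gx _] := norming_functional x.
apply/eqP; rewrite -normr_eq0 normE -gx fx0.
by rewrite re_part0 of_real0.
Qed.

End RealFunctionals.

(** * Uniform boundedness *)

Section UniformBoundedness.
Context {R : realType} {s : scalars}.
Local Notation K := (scalar_field R s).

(** Completeness in the quantitative form needed for the gliding hump, for use with both [X] and its
    dual. The radius is the sum of [3^-1 ^+ k] over [k > n]. *)
Definition geometrically_complete (Y : normedModType K) :=
  forall u : nat -> Y, (forall n, rnorm (u n.+1 - u n) <= 3^-1 ^+ n.+1) ->
  exists x, forall n, rnorm (x - u n) <= 3^-1 ^+ n / 2.

Record bounded_seminorm (Y : normedModType K) (q : Y -> R) : Prop := {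
  seminormD : forall x y, q (x + y) <= q x + q y;
  seminormZ : forall a x, q (of_real a *: x) = `|a| * q x;
  seminorm_bounded : exists M, forall x, q x <= M * rnorm x }.

Section Seminorm.
Context {Y : normedModType K} {q : Y -> R}.
Hypothesis hq : bounded_seminorm q.

Lemma seminormN x : q (- x) = q x.
Proof. by rewrite -scaleN1r -of_real1 -of_realN seminormZ// normrN1 mul1r. Qed.

(** [N] is the least bound of [q], a supremum of quotients exceeding [M]; the factor 2/3 allows it
    to be nearly attained. *)
Lemma seminorm_sharp_bound M : 0 <= M -> (exists x, M * rnorm x < q x) ->
  exists N, [/\ M <= N, forall x, q x <= N * rnorm x &
    exists x, 2 / 3 * N * rnorm x < q x].
Proof.
move=> M0 [z qz]; have [B HB] := seminorm_bounded hq.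
have nz0 : 0 < rnorm z.
  rewrite lt_neqAle rnorm_ge0 andbT eq_sym; apply: contraTneq qz => e.
  by have := HB z; rewrite e !mulr0 -leNgt.
pose S := [set q x / rnorm x | x in [set x | 0 < rnorm x]].
have Sz : S (q z / rnorm z) by exists z.
have ubS : has_ubound S by exists B => _ [x /= x0 <-]; rewrite ler_pdivrMr.
have leS x : q x <= sup S * rnorm x.
  have [x0|] := ltP 0 (rnorm x).
    by rewrite -ler_pdivrMr//; apply: ub_le_sup => //; exists x.
  move=> x0; have e : rnorm x = 0 by apply/eqP; rewrite eq_le x0 rnorm_ge0.
  by have := HB x; rewrite e !mulr0.
have MS : M < sup S.
  by rewrite (lt_le_trans _ (ub_le_sup ubS Sz))// ltr_pdivlMr.
exists (sup S); split => //; first exact: ltW.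
have [_ [x x0 <-]] : exists2 t, S t & 2 / 3 * sup S < t.
  apply: sup_gt; first by exists (q z / rnorm z).
  by have := le_lt_trans M0 MS; lra.
by rewrite ltr_pdivlMr// => ?; exists x.
Qed.

(** Let [h] be the multiple of [z] of norm [r]. Since [q (x + h) + q (x - h)] is at least [2 * q h],
    one of the two points satisfies the bound. *)
Lemma seminorm_step N r x : 0 < r -> 0 <= N ->
  (exists z, 2 / 3 * N * rnorm z < q z) ->
  exists x', rnorm (x' - x) <= r /\ 2 / 3 * N * r <= q x'.
Proof.
move=> r0 N0 [z qz]; have [B HB] := seminorm_bounded hq.
have nz0 : 0 < rnorm z.
  rewrite lt_neqAle rnorm_ge0 andbT eq_sym; apply: contraTneq qz => e.
  by have := HB z; rewrite e !mulr0 -leNgt.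
set h := of_real (r / rnorm z) *: z.
have hr : rnorm h = r by rewrite rnormZ_real ger0_norm ?divfK ?gt_eqF// divr_ge0// ltW.
have qh : 2 / 3 * N * r <= q h.
  rewrite seminormZ// ger0_norm; last by rewrite divr_ge0// ltW.
  rewrite [leRHS]mulrAC ler_pdivlMr//.
  by rewrite [leLHS]mulrAC [leLHS]mulrC ler_wpM2l// ltW.
have [|lt1] := leP (2 / 3 * N * r) (q (x + h)).
  by exists (x + h); rewrite addrC addKr hr.
exists (x - h); split; first by rewrite addrC addKr rnormN hr.
have := seminormD hq (x + h) (- (x - h)).
rewrite seminormN opprB [x + h + _]addrC addrA subrK.
have -> : h + h = of_real 2 *: h.
  by rewrite (_ : 2 = 1 + 1 :> R)// of_realD of_real1 scalerDl scale1r.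
by rewrite seminormZ// ger0_norm//; lra.
Qed.

End Seminorm.

(* Sokal's gliding hump: each step of the sequence [u] makes [q n] large, and
   the remaining steps are too short to undo this. *)
Theorem uniform_boundedness (Y : normedModType K) (Q : set (Y -> R)) :
  geometrically_complete Y -> (forall q, Q q -> bounded_seminorm q) ->
  (forall x, exists M, forall q, Q q -> q x <= M) ->
  exists M, forall q, Q q -> forall x, q x <= M * rnorm x.
Proof.
move=> cY Qb ptb; apply: contrapT => nb.
have /choice[qN qNP] (n : nat) : exists qN : (Y -> R) * R,
    [/\ Q qN.1, n%:R * 3 ^+ n.+1 <= qN.2, forall x, qN.1 x <= qN.2 * rnorm x &
    exists x, 2 / 3 * qN.2 * rnorm x < qN.1 x].
  have [q [Qq [x qx]]] : exists q, Q q /\ exists x, n%:R * 3 ^+ n.+1 * rnorm x < q x.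
    apply: contrapT => h; apply: nb; exists (n%:R * 3 ^+ n.+1) => q Qq x.
    by rewrite leNgt; apply/negP => qx; apply: h; exists q; split => //; exists x.
  have [||N [? ? ?]] := seminorm_sharp_bound (Qb _ Qq) (M := n%:R * 3 ^+ n.+1).
  - by rewrite mulr_ge0// exprn_ge0.
  - by exists x.
  - by exists (q, N).
have /choice[step stepP] (nx : nat * Y) : exists x',
    rnorm (x' - nx.2) <= 3^-1 ^+ nx.1.+1 /\
    2 / 3 * (qN nx.1).2 * 3^-1 ^+ nx.1.+1 <= (qN nx.1).1 x'.
  have [Qq Nn _ hx] := qNP nx.1.
  apply: (seminorm_step (Qb _ Qq)) => //.
  by apply: le_trans Nn; rewrite mulr_ge0// exprn_ge0.
pose u := fix u n := if n is m.+1 then step (m, u m) else 0.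
have [|x ux] := cY u; first by move=> n; exact: (stepP (n, u n)).1.
have [M HM] := ptb x.
have [n Mn] : exists n : nat, M < n%:R / 6.
  exists (Num.bound `|M * 6|); rewrite ltr_pdivlMr//.
  exact: le_lt_trans (ler_norm _) (archi_boundP (normr_ge0 _)).
have [Qq Nn qle _] := qNP n.
have := HM _ Qq; apply/negP; rewrite -ltNge; apply: lt_le_trans Mn _.
(* With [r = 3^-1 ^+ n.+1] and [N = (qN n).2], the value at [u n.+1] is at least [2/3 * N * r], and
   passing to [x] costs at most [N * r / 2]. What remains is [N * r / 6], at least [n / 6], hence
   above [M]. *)
have h1 := (stepP (n, u n)).2; have h2 := ux n.+1; have h3 := qle (u n.+1 - x).
have h4 := seminormD (Qb _ Qq) (u n.+1 - x) x; rewrite subrK in h4.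
rewrite rdistC in h3.
have r0 : 0 < 3^-1 ^+ n.+1 :> R by rewrite exprn_gt0.
have N0 : 0 <= (qN n).2 by apply: le_trans Nn; rewrite mulr_ge0// exprn_ge0.
have h5 : (qN n).2 * rnorm (x - u n.+1) <= (qN n).2 * (3^-1 ^+ n.+1 / 2).
  exact: ler_wpM2l.
have h6 : n%:R <= (qN n).2 * 3^-1 ^+ n.+1.
  by rewrite exprVn -ler_pdivrMr ?invr_gt0 ?exprn_gt0// invrK.
rewrite /= in h1; move: h1 h2 h3 h4 h5 h6; rewrite /=.
set r := _ ^+ _; lra.
Qed.

End UniformBoundedness.

Lemma geometric_small (R : realType) (e : R) : 0 < e -> exists n, 3^-1 ^+ n < e.
Proof.
move=> e0; have : 3^-1 ^+ n @[n --> \oo] --> (0 : R).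
  by apply: cvg_expr; rewrite ger0_norm// invf_lt1// ltr1n.
move=> /cvgrPdist_lt/(_ _ e0)[n _ Hn]; exists n.
by have := Hn n (leqnn n); rewrite /= sub0r normrN ger0_norm// exprn_ge0.
Qed.

(** * Completeness of the space and of its dual *)

Section Completeness.
Context {R : realType} {s : scalars}.
Local Notation K := (scalar_field R s).

Lemma geometric_tail {Y : normedModType K} (u : nat -> Y) :
  (forall n, rnorm (u n.+1 - u n) <= 3^-1 ^+ n.+1) ->
  forall n m, (n <= m)%N -> rnorm (u m - u n) <= 3^-1 ^+ n / 2.
Proof.
move=> ug n m nm; rewrite -(subnKC nm); move: (m - n)%N => k {m nm}.
suff : rnorm (u (n + k)%N - u n) <= (3^-1 ^+ n - 3^-1 ^+ (n + k)) / 2.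
  have : 0 < 3^-1 ^+ (n + k) :> R by rewrite exprn_gt0.
  lra.
elim: k => [|k IH]; first by rewrite addn0 !subrr mul0r rnorm0.
rewrite addnS -(subrKA (u (n + k)%N)) (le_trans (ler_rnormD _ _))//.
by have := ug (n + k)%N; rewrite exprS; move: IH; set r := _ ^+ (n + k); lra.
Qed.

Lemma complete_geometrically_complete (X : completeNormedModType K) :
  geometrically_complete X.
Proof.
move=> u ug; have tail := geometric_tail ug.
have small (e : K) : 0 < e -> exists n, 3^-1 ^+ n < re_part e.
  move=> e0; apply: geometric_small.
  by rewrite -(ltr_of_real (s := s)) of_real0 of_real_re// ltW.
have r_le1 n : 3^-1 ^+ n / 2 < 3^-1 ^+ n :> R.
  by rewrite ltr_pdivrMr// ltr_pMr// ?exprn_gt0// ltr1n.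
have cu : cvg (u @ \oo).
  apply/cauchy_cvgP/cauchy_exP => e e0; have [n ne] := small _ e0.
  exists (u n); exists n => //= m nm; rewrite -ball_normE /= normE rdistC.
  rewrite -(of_real_re (ltW e0)) ltr_of_real.
  exact: le_lt_trans (tail _ _ nm) (lt_trans (r_le1 n) ne).
exists (lim (u @ \oo)) => n; apply/ler_addgt0Pr => e e0.
have e0' : 0 < of_real e :> K by rewrite -of_real0 ltr_of_real.
have /cvgrPdist_lt/(_ _ e0')[m _ Hm] := cu.
have := Hm (maxn n m) (leq_maxr n m); rewrite /= normE ltr_of_real => le_e.
have := tail n (maxn n m) (leq_maxl n m) => le_n.
by rewrite -(subrKA (u (maxn n m))) (le_trans (ler_rnormD _ _))// addrC lerD// ltW.
Qed.

(** The limit is built pointwise on real parts. Additivity and real homogeneity hold up to errors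
    that tend to 0, and the functional is recovered from its real part. *)
Lemma dual_geometrically_complete (X : normedModType K) :
  geometrically_complete (dual X).
Proof.
move=> u ug; have tail := geometric_tail ug.
pose r n : R := 3^-1 ^+ n / 2.
have r_gt0 n : 0 < r n by rewrite divr_gt0// exprn_gt0.
have r_small (c C : R) : 0 <= C -> (forall n, `|c| <= r n * C) -> c = 0.
  move=> C0 cr; apply/eqP; rewrite -normr_le0 leNgt; apply/negP => c0.
  have C1 : 0 < C + 1 by rewrite ltr_wpDl.
  have [n] := geometric_small (divr_gt0 c0 C1); apply/negP; rewrite -leNgt.
  rewrite ler_pdivrMr//; apply: le_trans (cr n) _.
  have : 0 < 3^-1 ^+ n :> R by rewrite exprn_gt0.
  by rewrite /r; set t := _ ^+ n => t0; nra.
have dist x (i j : nat) : (i <= j)%N ->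
    `|re_part (u j x) - re_part (u i x)| <= r i * rnorm x.
  move=> ij; rewrite -re_partN -re_partD; apply: le_trans (ler_norm_re_part _) _.
  apply: le_trans (ler_rnorm_blin (u j - u i) x) _.
  by rewrite ler_wpM2r ?rnorm_ge0// tail.
have below x n m :
    re_part (u m x) - r m * rnorm x <= re_part (u n x) + r n * rnorm x.
  have rx i : 0 <= r i * rnorm x by rewrite mulr_ge0 ?rnorm_ge0// ltW.
  have := rx n; have := rx m.
  have [/(dist x)|/ltnW/(dist x)] := leqP n m; rewrite ler_norml => /andP[]; lra.
(* The intervals of radius [r n * rnorm x] about [re_part (u n x)] meet pairwise, so the supremum of
   their left ends lies in all of them. *)
pose v x := sup [set re_part (u n x) - r n * rnorm x | n in [set: nat]].
have vu x n : `|v x - re_part (u n x)| <= r n * rnorm x.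
  have ubS m : ubound [set re_part (u n x) - r n * rnorm x | n in [set: nat]]
    (re_part (u m x) + r m * rnorm x) by move=> _ [k _ <-]; exact: below.
  have : v x <= re_part (u n x) + r n * rnorm x.
    by apply: ge_sup (ubS n); exists (re_part (u 0 x) - r 0 * rnorm x), 0.
  have : re_part (u n x) - r n * rnorm x <= v x.
    apply: ub_le_sup; last by exists n.
    by exists (re_part (u 0 x) + r 0 * rnorm x); exact: ubS.
  by rewrite ler_norml; lra.
have [x y|a x|x|f fv] := @dual_of_real_part R s X v (rnorm (u 0) + r 0).
- apply/subr0_eq/(r_small _ (rnorm (x + y) + rnorm x + rnorm y)).
    by rewrite !addr_ge0// rnorm_ge0.
  move=> n; have := vu (x + y) n; have := vu x n; have := vu y n.
  rewrite linearD re_partD !ler_norml !mulrDr; lra.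
- apply/subr0_eq/(r_small _ (rnorm (of_real a *: x) + `|a| * rnorm x)).
    by rewrite addr_ge0// ?mulr_ge0// rnorm_ge0.
  move=> n; have h1 := vu (of_real a *: x) n.
  have h2 : `|a * (v x - re_part (u n x))| <= `|a| * (r n * rnorm x).
    by rewrite normrM ler_wpM2l.
  move: h1 h2; rewrite linearZ re_part_of_realM !ler_norml !mulrDr mulrN.
  rewrite [r n * (_ * _)]mulrCA; lra.
- have := vu x 0; rewrite ler_norml mulrDl => /andP[_ h].
  have := ler_rnorm_blin (u 0) x; have := ler_re_part_norm (u 0 x).
  by rewrite -/(rnorm _); lra.
exists f => n; apply: rnorm_blin_le => [|x]; first exact: ltW.
apply: rnorm_le_re_part => [|{}x]; first exact: blin_linear.
rewrite (_ : (f - u n) x = f x - u n x)// re_partD re_partN fv.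
exact: le_trans (ler_norm _) (vu x n).
Qed.

End Completeness.

Section WeaklyBounded.
Context {R : realType} {s : scalars}.
Local Notation K := (scalar_field R s).

(** The seminorms [rnorm (g (T y))], for [g] in the dual unit ball, are bounded at [y] by
    [rnorm (T y)]. A norming functional turns their uniform bound into one for [T]. *)
Lemma weakly_bounded_bounded (Y Z : normedModType K) (T : Y -> Z) :
  geometrically_complete Y -> linear T ->
  (forall g : dual Z, exists M, forall y, rnorm (g (T y)) <= M * rnorm y) ->
  T \in bounded_linear.
Proof.
move=> cY lT wb; apply: bounded_linear_rnorm => //.
have TD x y : T (x + y) = T x + T y by have := lT 1 x y; rewrite !scale1r.
have T0 : T 0 = 0 by apply: (addrI (T 0)); rewrite -TD !addr0.
have TZ k x : T (k *: x) = k *: T x by have := lT k x 0; rewrite T0 !addr0.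
pose Q := [set (fun y => rnorm (g (T y))) | g in
  [set g : dual Z | forall z, rnorm (g z) <= rnorm z]].
have [_ [g _ <-]||M HM] := @uniform_boundedness R s Y Q cY.
- split=> [x y|a x|]; last exact: wb.
    by rewrite TD linearD; exact: ler_rnormD.
  by rewrite TZ linearZ; exact: rnormZ_real.
- by move=> x; exists (rnorm (T x)) => _ [g gle <-].
exists M => x; have [g gx gle] := norming_functional (T x).
rewrite -gx; apply: le_trans (ler_re_part_norm _) _.
by apply: (HM (fun y => rnorm (g (T y)))); exists g.
Qed.

End WeaklyBounded.

(** * Traces and rank-one idempotents *)

Section TraceOfTensors.
Context {K : numFieldType} {V : normedModType K}.

Lemma sum_tensorE n (x : 'I_n -> V) (f : 'I_n -> dual V) y :
  (\sum_i tensor (x i) (f i)) y = \sum_i f i y *: x i.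
Proof. by elim/big_rec2: _ => // i T v _ <-. Qed.

(* The Gram matrix [M i j = f i (x j)] squares to zero; factoring it as [C R]
   through its rank gives [R C = 0], so that [tr (C R) = tr (R C) = 0]. *)
Lemma trace_sum_eq0 n (x : 'I_n -> V) (f : 'I_n -> dual V) :
  \sum_i tensor (x i) (f i) = 0 -> \sum_i f i (x i) = 0.
Proof.
move=> T0; pose M : 'M[K]_n := \matrix_(i, j) f i (x j).
have MM : M *m M = 0.
  apply/matrixP => i j; rewrite !mxE.
  have -> : \sum_k M i k * M k j = f i ((\sum_k tensor (x k) (f k)) (x j)).
    rewrite sum_tensorE linear_sum; apply: eq_bigr => k _.
    by rewrite !mxE linearZ mulrC.
  by rewrite T0 linear0.
have -> : \sum_i f i (x i) = \tr M by apply: eq_bigr => i _; rewrite mxE.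
rewrite -(mulmx_base M) mxtrace_mulC; suff -> : row_base M *m col_base M = 0.
  by rewrite mxtrace0.
apply: (row_full_inj (col_base_full M)); rewrite mulmx0.
apply: (row_free_inj (row_base_free M)); rewrite mul0mx.
transitivity ((col_base M *m row_base M) *m (col_base M *m row_base M)).
  by rewrite !mulmxA.
by rewrite mulmx_base.
Qed.

(** Adjoining the pair [(x, - f)] to a representation of [tensor x f] gives one of the zero
    operator, to which [trace_sum_eq0] applies. *)
Lemma is_trace_tensor (x : V) (f : dual V) t : is_trace (tensor x f) t -> t = f x.
Proof.
move=> [n [y [g [Te ->]]]].
pose y' (i : 'I_n.+1) := if unlift ord0 i is Some j then y j else x.
pose g' (i : 'I_n.+1) := if unlift ord0 i is Some j then g j else - f.
have sumE (U : nmodType) (F : V -> dual V -> U) :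
    \sum_i F (y' i) (g' i) = F x (- f) + \sum_i F (y i) (g i).
  rewrite big_ord_recl /y' /g' unlift_none; congr (_ + _).
  by apply: eq_bigr => i _; rewrite liftK.
have := @trace_sum_eq0 _ y' g'.
rewrite (sumE _ (fun x f => tensor x f)) (sumE _ (fun x (f : dual V) => f x)) -Te.
rewrite -[(- f) x]/(- f x) [- f x + _]addrC => h; apply/subr0_eq/h/blinP => u.
rewrite -[LHS]/((- f) u *: x + f u *: x) -scalerDl -[(- f) u]/(- f u) addNr.
by rewrite scale0r.
Qed.

Lemma tr_tensor (x : V) (f : dual V) : tr (tensor x f) = f x.
Proof.
rewrite /tr; case: xgetP => [t _ /is_trace_tensor //|/(_ (f x))] []; exists 1%N.
by exists (fun=> x), (fun=> f); rewrite !big_ord1.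
Qed.

Lemma bcomp_tensor (x y : V) (f g : dual V) :
  bcomp (tensor x f) (tensor y g) = tensor (f y *: x) g.
Proof. by apply: blinP => u /=; rewrite linearZ scalerA. Qed.

Lemma tr_bcomp_tensor (x y : V) (f g : dual V) :
  tr (bcomp (tensor x f) (tensor y g)) = g x * f y.
Proof. by rewrite bcomp_tensor tr_tensor linearZ mulrC. Qed.

Lemma tensorZ k (x : V) (f : dual V) : k != 0 ->
  tensor (k *: x) (k^-1 *: f) = tensor x f.
Proof.
move=> k0; apply: blinP => u /=.
rewrite -[LHS]/((k^-1 * f u) *: (k *: x)).
by rewrite scalerA mulrAC mulVf// mul1r.
Qed.

Lemma tensor_I1 (x : V) (f : dual V) : f x = 1 -> I1 V (tensor x f).
Proof.
move=> fx; split; last by rewrite bcomp_tensor fx scale1r.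
have x0 : x != 0.
  by apply/eqP => x0; move: fx; rewrite x0 linear0 => /eqP; rewrite eq_sym oner_eq0.
exists x => //; apply/seteqP; split=> _ [u _ <-] /=; first by exists (f u).
by exists (u *: x); rewrite // linearZ /= fx [u *: 1]mulr1.
Qed.

End TraceOfTensors.

(** If [x] spans the range and [g x = 1], then [g] composed with [P] reads off the coefficient of
    [x]; idempotence gives [P x = x]. *)
Lemma I1_tensor (R : realType) (s : scalars) (V : normedModType (scalar_field R s))
    (P : blin V V) : I1 V P -> exists x (f : dual V), P = tensor x f /\ f x = 1.
Proof.
move=> [[x x0 Pr] PP].
have [g gx] : exists g : dual V, g x = 1.
  have /existsNP[g /eqP gx] : ~ forall g : dual V, g x = 0.
    by move=> /dual_separates x_0; rewrite x_0 eqxx in x0.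
  by exists ((g x)^-1 *: g); exact: mulVf.
have PE : P = tensor x (bcomp g P).
  apply: blinP => u /=; have : range P (P u) by exists u.
  by rewrite Pr => -[k _ <-]; rewrite linearZ /= gx [k *: 1]mulr1.
exists x, (bcomp g P); split => //=.
have : range (fun k => k *: x) x by exists 1; rewrite // scale1r.
by rewrite -Pr => -[u _ Pu]; rewrite -{1}Pu -[P (P u)]/(bcomp P P u) PP Pu.
Qed.

(** * The relation induced by [phi] on [X] and its dual *)

Section Main.
Context {R : realType} {s : scalars} {X : completeNormedModType (scalar_field R s)}.
Local Notation K := (scalar_field R s).

Lemma evaluation_linr (x : X) : linear (fun f : dual X => f x : K^o).
Proof. by []. Qed.

Lemma evaluation_linl (f : dual X) : linear (fun x : X => f x : K^o).
Proof. by move=> k x y; rewrite linearP. Qed.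

Lemma evaluation_sepr (f : dual X) : (forall x, f x = 0) -> f = 0.
Proof. by move=> f0; exact: blinP. Qed.

Definition evaluation : dual_pair X (dual X) :=
  DualPair evaluation_linl evaluation_linr (@dual_separates R s X) evaluation_sepr.

Variable phi : I1 X -> I1 X.
Hypothesis phi_bij : bijective phi.
Hypothesis phi_tr : forall P Q : I1 X,
  tr (bcomp (val (phi P)) (val (phi Q))) = tr (bcomp (val P) (val Q)).

(** A relation instead of a function, because an idempotent determines its two factors only up to
    reciprocal scalars. *)
Definition maps_tensor (x : X) (f : dual X) (y : X) (g : dual X) :=
  [/\ f x = 1, g y = 1 & exists P : I1 X,
     val P = tensor x f /\ val (phi P) = tensor y g].

Lemma I1E (P : I1 X) : exists x (f : dual X), val P = tensor x f /\ f x = 1.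
Proof. by apply: I1_tensor; exact: set_mem (valP P). Qed.

Lemma maps_tensor_trace_rel : trace_rel evaluation evaluation maps_tensor.
Proof.
have inI1 x (f : dual X) : f x = 1 -> exists P : I1 X, val P = tensor x f.
  by move=> /tensor_I1/mem_set PI; exists (SigSub PI).
split=> /=.
- by move=> x f y g [].
- move=> x f fx; have [P PE] := inI1 x f fx; have [y [g [QE gy]]] := I1E (phi P).
  by exists y, g; split=> //; exists P.
- move=> y g gy; have [Q QE] := inI1 y g gy; case: phi_bij => psi _ psiK.
  have [x [f [PE fx]]] := I1E (psi Q).
  by exists x, f; split=> //; exists (psi Q); rewrite psiK.
- move=> k x f y g k0 [fx gy [P [PE QE]]]; split => //.
    rewrite linearZ /= -[RHS](mulfV k0); congr (_ * _).
    by rewrite -[LHS]/(k^-1 * f x) fx mulr1.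
  by exists P; rewrite tensorZ.
- move=> k x f y g k0 [fx gy [P [PE QE]]]; split => //.
    rewrite linearZ /= -[RHS](mulfV k0); congr (_ * _).
    by rewrite -[LHS]/(k^-1 * g y) gy mulr1.
  by exists P; rewrite tensorZ.
- move=> x f y g x' f' y' g' [_ _ [P [PE QE]]] [_ _ [P' [PE' QE']]].
  by have := phi_tr P P'; rewrite PE PE' QE QE' !tr_bcomp_tensor.
Qed.

Lemma maps_tensorE (P : I1 X) x f y g : val P = tensor x f ->
  maps_tensor x f y g -> val (phi P) = tensor y g.
Proof.
move=> PE [_ _ [P' [PE' <-]]]; congr (val (phi _)); apply: val_inj.
by rewrite PE.
Qed.

End Main.

Theorem theorem1 (R : realType) (s : scalars)
    (X : completeNormedModType (scalar_field R s)) (phi : I1 X -> I1 X) :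
  bijective phi ->
  (forall P Q : I1 X,
    tr (bcomp (val (phi P)) (val (phi Q))) = tr (bcomp (val P) (val Q))) ->
  (exists (A : blin X X) (Ainv : X -> X),
    [/\ cancel A Ainv, cancel Ainv A
      & forall P : I1 X, val (phi P) = A \o val P \o Ainv :> (X -> X)])
  \/
  (exists (C : blin (dual X) X) (Cinv : X -> dual X),
    [/\ cancel C Cinv, cancel Cinv C
      & forall P : I1 X,
          val (phi P) = C \o adjoint (val P) \o Cinv :> (X -> X)]).
Proof.
move=> phi_bij phi_tr.
(* Without rank-one idempotents there is no base point, and the identity operator satisfies the
   claim vacuously. *)
have [[P0 _]|noP] := pselect (exists P : I1 X, True); last first.
  have idb : id \in @bounded_linear _ X X.
    by apply/bounded_linearP; split => //; exists 1 => x; rewrite mul1r.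
  left; exists (Blin idb), id; split => // P; exfalso; apply: noP.
  by exists P.
have H := maps_tensor_trace_rel phi_bij phi_tr.
have [x0 [f0 [P0E fx0]]] := I1E P0; have [y0 [g0 [Q0E gy0]]] := I1E (phi P0).
have r0 : maps_tensor phi x0 f0 y0 g0 by split=> //; exists P0.
have [[row col]|[row col]] := base_dichotomy H r0; [left|right].
  have [A [A' [B [B' [[lA AK AK'] [BK AB rho]]]]]] := spatial H r0 row col.
  have bA : A \in bounded_linear.
    apply: weakly_bounded_bounded => //; first exact: complete_geometrically_complete.
    (* Duality between [A] and [B] gives [g (A x) = (B' g) x], and [B' g] is a bounded
       functional. *)
    move=> g; have [M HM] := blin_rbounded (B' g); exists M => x.
    by have /= := AB x (B' g); rewrite BK => ->.
  exists (Blin bA), A'; split => // P; have [x [f [PE fx]]] := I1E P.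
  rewrite (maps_tensorE PE (rho _ _ fx)); apply/funext => u.
  rewrite /comp PE (_ : tensor x f (A' u) = f (A' u) *: x)// linearZ.
  congr (_ *: _).
  by have /= := AB (A' u) f; rewrite AK'.
have [C [C' [B [B' [[lC CK CK'] [BK CB rho]]]]]] :=
  spatial (trace_rel_flip_source H) (r0 : flip_source _ f0 x0 y0 g0) col row.
have bC : C \in bounded_linear.
  apply: weakly_bounded_bounded => //; first exact: dual_geometrically_complete.
  (* Here [B' g] is a vector of [X] with [g (C f) = f (B' g)], so its norm is the bound. *)
  move=> g; exists (rnorm (B' g)) => f.
  by have /= := CB f (B' g); rewrite BK => ->; rewrite mulrC ler_rnorm_blin.
exists (Blin bC), C'; split => // P; have [x [f [PE fx]]] := I1E P.
rewrite (maps_tensorE PE (rho _ _ fx)); apply/funext => u; rewrite /comp.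
have -> : adjoint (val P) (C' u) = C' u x *: f.
  by apply: blinP => v /=; rewrite PE /= linearZ [LHS]mulrC.
rewrite linearZ; congr (_ *: _).
by have /= := CB (C' u) x; rewrite CK'.
Qed.
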